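(* Consider the linear dynamical network $\dot x = Ax+Bu$, $y=Cx$ with $A\in\mathbb{R}^{N\times N}$, $B\in\mathbb{R}^{N\times M}$, $C\in\mathbb{R}^{P\times N}$, where each row of $C$ is a canonical unit (row) vector, and with nodes $\mathcal{V}=\{v_1,\dots,v_N\}$. Let $\mathcal{O}\subseteq\mathcal{V}$ denote the set of observable nodes, i.e. the maximal set of simultaneously observable nodes. Then: (i) the maximal number of observable nodes $|\mathcal{O}|$ always coincides with the largest number of elements $e_i$ of the canonical basis $\mathcal{N}=\{e_1,\dots,e_N\}$ of $\mathbb{R}^N$ that are orthogonal to the non observable subspace of the pair $(A,C)$; (ii) the set of observable nodes $\mathcal{O}$ is unique; (iii) the set of observable nodes $\mathcal{O}$ is generic: for a given matrix $C$ and a given pattern of fixed (zero) and free entries of $A$, the set $\mathcal{O}$ is the same for all values of the free entries of $A$ except for a set of values of Lebesgue measure zero in the space of the free entries.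
   Context: The network has nodes $v_1,\dots,v_N$; the scalar $x_i$ (the $i$-th component of $x\in\mathbb{R}^N$) is the state of node $v_i$, $A$ encodes the intrinsic node dynamics (diagonal entries) and the edges (for $i\neq j$, $a_{ij}\neq0$ iff there is an edge from $v_j$ to $v_i$), and the output $y$ is the stack vector of the states of the sensor nodes: each row of $C$ has a single nonzero entry, equal to $1$, whose position $j$ indicates that $v_j$ is a sensor node. A node $v_j$ is observable iff it is possible to reconstruct the value of its state $x_j$ from knowledge of the control signals $u$ and of the measured states $y$ of the sensor nodes, i.e. iff $x_j(\cdot)$ on a time interval $[0,T]$, $T>0$, is uniquely determined by $u(\cdot)$ and $y(\cdot)$ on that interval (the matrices $A,B,C$ being known). A set of nodes is simultaneously observable iff the states of all its nodes can be so reconstructed simultaneously. The set of observable nodes $\mathcal{O}$ is a maximal set of nodes that are simultaneously observable. The non observable subspace of $(A,C)$ is the null space of the observability matrix obtained by stacking $C, CA,\dots,CA^{N-1}$. An entry of a structured matrix is fixed if its value is constrained to be zero and free if it can take an arbitrary value. *)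

(* Defs.v *)
From mathcomp Require Export all_boot all_order all_algebra.
From mathcomp Require Export all_classical all_reals all_analysis.
Export numFieldNormedType.Exports.

Set Implicit Arguments.
Unset Strict Implicit.
Unset Printing Implicit Defensive.

Import Order.TTheory GRing.Theory Num.Theory.
Local Open Scope classical_set_scope.
Local Open Scope ring_scope.

(* The node v_(i+1) is represented by its index i : 'I_N. *)

Definition rows_are_unit (R : realType) (P N : nat) (C : 'M[R]_(P, N)) : Prop :=
  forall p : 'I_P, exists j : 'I_N, row p C = delta_mx 0 j.

(* The equation may fail at finitely many instants, so that controls with jumps
   (e.g. piecewise continuous ones) are admitted. *)
Definition trajectory (R : realType) (N M : nat) (A : 'M[R]_N) (B : 'M[R]_(N, M))
    (T : R) (u : R -> 'cV[R]_M) (x : R -> 'cV[R]_N) : Prop :=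
  {within `[0, T], continuous x} /\
  exists s : seq R, forall t : R, t \in `]0, T[ -> t \notin s ->
    is_derive t 1 x (A *m x t + B *m u t).

Definition simultaneously_observable (R : realType) (N M P : nat)
    (A : 'M[R]_N) (B : 'M[R]_(N, M)) (C : 'M[R]_(P, N)) (T : R)
    (S : {set 'I_N}) : Prop :=
  forall (u : R -> 'cV[R]_M) (x x' : R -> 'cV[R]_N),
    trajectory A B T u x -> trajectory A B T u x' ->
    (forall t : R, t \in `[0, T] -> C *m x t = C *m x' t) ->
    forall t : R, t \in `[0, T] -> forall j, j \in S -> x t j 0 = x' t j 0.

(* Maximality is with respect to inclusion. *)
Definition observable_nodes (R : realType) (N M P : nat)
    (A : 'M[R]_N) (B : 'M[R]_(N, M)) (C : 'M[R]_(P, N)) (T : R)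
    (O : {set 'I_N}) : Prop :=
  maxset (fun S => `[< simultaneously_observable A B C T S >]) O.

Definition observability_matrix (R : realType) (N P : nat)
    (A : 'M[R]_N) (C : 'M[R]_(P, N)) : 'M[R]_((\sum_(k < N) P)%N, N) :=
  \mxcol_(k < N) (C *m A ^+ k).

Definition nonobservable_subspace (R : realType) (N P : nat)
    (A : 'M[R]_N) (C : 'M[R]_(P, N)) : set 'cV[R]_N :=
  [set v | observability_matrix A C *m v = 0].

Definition basis_vector (R : realType) (N : nat) (i : 'I_N) : 'cV[R]_N :=
  delta_mx i 0.

Definition orthogonal_to (R : realType) (N : nat) (w : 'cV[R]_N)
    (V : set 'cV[R]_N) : Prop :=
  forall v, V v -> w^T *m v = 0.

(* S ranges over the sets of indices of elements of the canonical basis. *)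
Definition max_orthogonal_basis_vectors (R : realType) (N : nat)
    (V : set 'cV[R]_N) : nat :=
  \max_(S : {set 'I_N} |
      [forall i in S, `[< orthogonal_to (basis_vector R i) V >]]) #|S|.

(* F is the set of free positions; the value of the k-th of them, in the order
   of enum F, is the k-th component of a. *)
Definition matrix_of_free_entries (R : realType) (N : nat)
    (F : {set 'I_N * 'I_N}) (a : #|F|.-tuple R) : 'M[R]_N :=
  \matrix_(i, j) if (i, j) \in F then nth 0 a (index (i, j) (enum F)) else 0.

(* The n-fold product of the Lebesgue measure of R, transported to n-tuples;
   R^0 is a point of mass 1. *)
Fixpoint tuple_lebesgue (R : realType) (n : nat) : set (n.-tuple R) -> \bar R :=
  match n with
  | 0 => dirac [tuple]
  | m.+1 => fun X => (lebesgue_measure \x tuple_lebesgue (R := R) (n := m))%E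
                       [set p | X (cons_tuple p.1 p.2)]
  end.

(* Main.v *)
Require Import Defs.
From mathcomp Require Import measurable_realfun.

Set Implicit Arguments.
Unset Strict Implicit.
Unset Printing Implicit Defensive.

Import Order.TTheory GRing.Theory Num.Theory.
Local Open Scope classical_set_scope.
Local Open Scope ring_scope.

(** Node j can be reconstructed exactly when the row e_j lies in the row space
    of the observability matrix, that is, when e_j is orthogonal to the non
    observable subspace.  All three claims follow from this criterion
    ([simultaneously_observableE]): it is a condition on each node separately,
    so the simultaneously observable sets are the subsets of one fixed set,
    [reconstructible_nodes A C], which is therefore the only maximal one; and
    the number of its elements is the maximum of part (i).

    Sufficiency of the criterion: the difference z of two trajectories with the
    same control and the same output solves z' = A z off a finite set of
    instants, with C z = 0.  Differentiating gives C A z = 0 off that finite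
    set, hence everywhere by continuity, and inductively C A^k z = 0 for all k
    ([homogeneous_solution_unobserved]); so z stays in the non observable
    subspace.  Necessity: for v in the non observable subspace, C A^k v = 0 for
    every k by Cayley-Hamilton, so the solution e^(tA) v of x' = A x is
    indistinguishable from the zero solution ([nonobservable_flow]).  The
    exponential is built row by row: for each row w, the scalar function
    w e^(tA) v is an everywhere convergent power series, differentiated term by
    term.

    Genericity: the criterion compares the rank of the observability matrix
    with its rank after e_j is appended as a row, and the entries of all these
    matrices are polynomials in the free entries of A.  Choose values a0 of the
    free entries that maximise the sum of these N + 1 ranks.  A rank is bounded
    below by the size of a nonzero determinant det (L G U) with L and U constant,
    and the product of the determinants that witness the ranks at a0 is a
    polynomial that does not vanish at a0.  Where it does not vanish no rank is
    below its value at a0, so by maximality none is above either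
    ([generic_rank]).  Finally the zeros of a polynomial that is not identically
    zero form a null set ([polynomial_function_null_zeros]), by induction on the
    number of variables. *)

(** * Zeros of polynomial functions *)

Lemma finite_roots (R : realType) (p : {poly R}) :
  p != 0 -> finite_set [set x | p.[x] = 0].
Proof.
move=> p0; apply: contrapT => /(@infinite_set_fset _ _ (size p))[rs rsP rs_size].
suff : (size (finmap.enum_fset rs) < size p)%N by rewrite ltnNge rs_size.
apply: max_poly_roots => //; last exact: finmap.fset_uniq.
by apply/allP => x xrs; apply/rootP; exact: rsP.
Qed.

(** A closure under sums and products rather than a type of polynomials: null
    zero sets only require that fixing some of the coordinates leaves a
    polynomial function of the others. *)
Inductive polynomial_function (R : realType) (n : nat) :
    (n.-tuple R -> R) -> Prop :=
| polynomial_function_cst c : polynomial_function (fun=> c)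
| polynomial_function_tnth i : polynomial_function (fun a => tnth a i)
| polynomial_functionD f g : polynomial_function f -> polynomial_function g ->
    polynomial_function (fun a => f a + g a)
| polynomial_functionM f g : polynomial_function f -> polynomial_function g ->
    polynomial_function (fun a => f a * g a).

Lemma polynomial_function_sum (R : realType) (n : nat) (I : Type) (r : seq I)
    (f : I -> n.-tuple R -> R) :
  (forall i, polynomial_function (f i)) ->
  polynomial_function (fun a => \sum_(i <- r) f i a).
Proof.
move=> pf; elim: r => [|i r IHr].
  under eq_fun do rewrite big_nil.
  exact: polynomial_function_cst.
under eq_fun do rewrite big_cons.
exact: polynomial_functionD.
Qed.

Lemma polynomial_function_prod (R : realType) (n : nat) (I : Type) (r : seq I)
    (f : I -> n.-tuple R -> R) :
  (forall i, polynomial_function (f i)) ->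
  polynomial_function (fun a => \prod_(i <- r) f i a).
Proof.
move=> pf; elim: r => [|i r IHr].
  under eq_fun do rewrite big_nil.
  exact: polynomial_function_cst.
under eq_fun do rewrite big_cons.
exact: polynomial_functionM.
Qed.

Lemma polynomial_function_cons_tail (R : realType) (n : nat)
    (f : n.+1.-tuple R -> R) (x : R) :
  polynomial_function f -> polynomial_function (fun a => f (cons_tuple x a)).
Proof.
elim=> [c|i|{}f g _ pf _ pg|{}f g _ pf _ pg].
- exact: polynomial_function_cst.
- case: (unliftP ord0 i) => [j|] ->.
    under eq_fun do rewrite tnthS.
    exact: polynomial_function_tnth.
  under eq_fun do rewrite tnth0.
  exact: polynomial_function_cst.
- exact: (polynomial_functionD pf pg).
- exact: (polynomial_functionM pf pg).
Qed.

Lemma polynomial_function_cons_head (R : realType) (n : nat)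
    (f : n.+1.-tuple R -> R) (a : n.-tuple R) :
  polynomial_function f ->
  exists p : {poly R}, forall x, f (cons_tuple x a) = p.[x].
Proof.
elim=> [c|i|{}f g _ [p fp] _ [q gq]|{}f g _ [p fp] _ [q gq]].
- by exists c%:P => x; rewrite hornerC.
- case: (unliftP ord0 i) => [j|] ->.
    by exists (tnth a j)%:P => x; rewrite tnthS hornerC.
  by exists 'X => x; rewrite tnth0 hornerX.
- by exists (p + q) => x; rewrite hornerD fp gq.
- by exists (p * q) => x; rewrite hornerM fp gq.
Qed.

Lemma measurable_polynomial_function (R : realType) (n : nat)
    (f : n.-tuple R -> R) :
  polynomial_function f -> measurable_fun setT f.
Proof.
elim=> [c|i|{}f g _ mf _ mg|{}f g _ mf _ mg].
- exact: measurable_cst.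
- exact: measurable_tnth.
- exact: measurable_funD.
- exact: measurable_funM.
Qed.

(** A preimage is, up to a subset of [S], either empty or the complement of [S],
    and subsets of a finite set are measurable.  This is how the measure of a
    section of a zero set is seen to depend measurably on the point. *)
Lemma measurable_fun_finite_support (R : realType) (f : R -> \bar R)
    (S : set R) :
  finite_set S -> (forall x, ~ S x -> f x = 0%E) -> measurable_fun setT f.
Proof.
move=> finS f0 _ Y mY; rewrite setTI.
have -> : f @^-1` Y =
    (S `&` f @^-1` Y) `|` (if `[< Y 0%E >] then ~` S else set0).
  apply/seteqP; split=> [x /= Yfx|x].
    case: (pselect (S x)) => Sx; [by left|right].
    by move: Yfx; rewrite f0//; case: asboolP.
  by case=> [[]//|]; case: asboolP => //= Y0 Sx; rewrite f0.
apply: measurableU.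
  exact/countable_measurable/finite_set_countable/(sub_finite_set _ finS).
case: asboolP => // _; apply: measurableC.
exact/countable_measurable/finite_set_countable.
Qed.

Lemma tuple_lebesgue_ge0 (R : realType) (n : nat) (X : set (n.-tuple R)) :
  (0 <= tuple_lebesgue X)%E.
Proof.
elim: n X => [|n IHn] X; first exact: measure_ge0.
by apply: integral_ge0 => x _; exact: IHn.
Qed.

(** Fubini for null sets, in the case where the exceptional fibres, possibly of
    infinite measure, lie over finitely many points. *)
Lemma tuple_lebesgue_finite_fibers (R : realType) (n : nat)
    (X : set (n.+1.-tuple R)) (S : set R) :
  finite_set S ->
  (forall x, ~ S x -> tuple_lebesgue [set a | X (cons_tuple x a)] = 0%E) ->
  tuple_lebesgue X = 0%E.
Proof.
move=> finS X0.
set fiber := fun x => tuple_lebesgue [set a | X (cons_tuple x a)].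
have -> : tuple_lebesgue X = (\int[lebesgue_measure]_x fiber x)%E.
  apply: eq_integral => x _ /=; congr tuple_lebesgue.
  by rewrite /xsection; apply/seteqP; split => a /=; rewrite inE.
have cS : countable S by exact: finite_set_countable.
rewrite (@ge0_negligible_integral _ _ R lebesgue_measure setT S fiber).
- apply: integral0_eq => x [_ Sx]; exact: X0.
- exact: countable_measurable.
- exact: measurableT.
- exact: (measurable_fun_finite_support finS).
- by move=> x _; exact: tuple_lebesgue_ge0.
- exact: countable_lebesgue_measure0.
Qed.

(** Induction on the number of variables.  With the last variables fixed as in
    the nonzero [a], [f] is a nonzero polynomial in the first one, so it has
    finitely many roots; over any other value of the first variable, the fibre
    is the zero set of a polynomial function that is not identically zero. *)
Lemma polynomial_function_null_zeros (R : realType) (n : nat)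
    (f : n.-tuple R -> R) (a : n.-tuple R) :
  polynomial_function f -> f a != 0 ->
  tuple_lebesgue [set b | f b = 0] = 0%E.
Proof.
elim: n f a => [|n IHn] f a pf fa0.
  rewrite /= diracE memNset//= => f0.
  by move: fa0; rewrite tuple0 f0 eqxx.
have [p fp] := polynomial_function_cons_head (behead_tuple a) pf.
have p0 : p != 0.
  apply: contraNneq fa0 => p0.
  by rewrite [a]tuple_eta fp p0 horner0.
apply: (@tuple_lebesgue_finite_fibers _ _ _ [set x | p.[x] = 0]).
  exact: finite_roots.
move=> x /= px0.
apply: (IHn _ (behead_tuple a)).
  exact: polynomial_function_cons_tail.
by rewrite fp; apply/eqP.
Qed.

(** * Generic ranks of polynomial matrices *)

Definition polynomial_matrix (R : realType) (n p q : nat)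
    (G : n.-tuple R -> 'M[R]_(p, q)) : Prop :=
  forall i j, polynomial_function (fun a => G a i j).

Lemma polynomial_matrix_cst (R : realType) (n p q : nat) (D : 'M[R]_(p, q)) :
  polynomial_matrix (fun _ : n.-tuple R => D).
Proof. by move=> i j; exact: polynomial_function_cst. Qed.

Lemma polynomial_matrixM (R : realType) (n p q r : nat)
    (G : n.-tuple R -> 'M[R]_(p, q)) (H : n.-tuple R -> 'M[R]_(q, r)) :
  polynomial_matrix G -> polynomial_matrix H ->
  polynomial_matrix (fun a => G a *m H a).
Proof.
move=> pG pH i j; under eq_fun do rewrite mxE.
by apply: polynomial_function_sum => k; exact: polynomial_functionM.
Qed.

Lemma polynomial_matrixX (R : realType) (n p : nat)
    (G : n.-tuple R -> 'M[R]_p) (k : nat) :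
  polynomial_matrix G -> polynomial_matrix (fun a => G a ^+ k).
Proof.
move=> pG; elim: k => [|k IHk].
  by under eq_fun do rewrite expr0; exact: polynomial_matrix_cst.
under eq_fun do rewrite exprS -mulmxE.
exact: polynomial_matrixM.
Qed.

Lemma polynomial_function_det (R : realType) (n p : nat)
    (G : n.-tuple R -> 'M[R]_p) :
  polynomial_matrix G -> polynomial_function (fun a => \det (G a)).
Proof.
move=> pG; apply: polynomial_function_sum => s.
apply: polynomial_functionM; first exact: polynomial_function_cst.
by apply: polynomial_function_prod => i; exact: pG.
Qed.

(** With [mulmx_unit_rank_leq] this characterises the rank by determinants of
    products with constant matrices, in the role usually played by minors. *)
Lemma mulmx_rank_scalar (F : fieldType) (p q : nat) (D : 'M[F]_(p, q)) :
  exists (L : 'M[F]_(\rank D, p)) (U : 'M[F]_(q, \rank D)), L *m D *m U = 1%:M.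
Proof.
exists (pid_mx (\rank D) *m invmx (col_ebase D)).
exists (invmx (row_ebase D) *m pid_mx (\rank D)).
rewrite -[X in _ *m X *m _]mulmx_ebase !mulmxA.
rewrite (mulmxKV (col_ebase_unit D)) (mulmxK (row_ebase_unit D)).
rewrite pid_mx_id ?rank_leq_row// pid_mx_id ?rank_leq_col//.
by rewrite pid_mx_1.
Qed.

Lemma mulmx_unit_rank_leq (F : fieldType) (p q r : nat) (D : 'M[F]_(p, q))
    (L : 'M[F]_(r, p)) (U : 'M[F]_(q, r)) :
  \det (L *m D *m U) != 0 -> (r <= \rank D)%N.
Proof.
rewrite -unitfE -unitmxE => /mxrank_unit {1}<-.
exact: leq_trans (mxrankM_maxl _ _) (mxrankM_maxr _ _).
Qed.

(** A point that maximises the sum of the ranks serves all of them at once: a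
    single polynomial, nonzero at that point, bounds every rank from below, and
    an excess in one of them would increase the sum. *)
Lemma generic_rank (R : realType) (n p q : nat) (K : finType)
    (G : K -> n.-tuple R -> 'M[R]_(p, q)) :
  (forall k, polynomial_matrix (G k)) ->
  exists a0, (@tuple_lebesgue R n).-negligible
    [set a | ~ forall k, \rank (G k a) = \rank (G k a0)].
Proof.
move=> pG; pose total a := (\sum_k \rank (G k a))%N.
have [a0 a0_max] : exists a0, forall a, (total a <= total a0)%N.
  have total_bound m : `[< exists a, m = total a >] -> (m <= \sum_(k : K) p)%N.
    by move=> /asboolP[a ->]; apply: leq_sum => k _; exact: rank_leq_row.
  have total_ex : exists m, `[< exists a, m = total a >].
    by exists (total (nseq_tuple n 0)); apply/asboolP; exists (nseq_tuple n 0).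
  have [_ /asboolP[a0 ->] max_a0] := ex_maxnP total_ex total_bound.
  by exists a0 => a; apply: max_a0; apply/asboolP; exists a.
exists a0.
have /(_ _)/cid2-/all_sig2[L] : forall k, exists2 L : 'M[R]_(\rank (G k a0), p),
   True & exists U : 'M[R]_(q, \rank (G k a0)), L *m G k a0 *m U = 1%:M.
  move=> k; have [L [U LU]] := mulmx_rank_scalar (G k a0).
  by exists L => //; exists U.
move=> _ /(_ _)/cid-/all_sig[U LU].
pose f a := \prod_k \det (L k *m G k a *m U k).
have pf : polynomial_function f.
  apply: polynomial_function_prod => k; apply: polynomial_function_det.
  apply: polynomial_matrixM; last exact: polynomial_matrix_cst.
  by apply: polynomial_matrixM; first exact: polynomial_matrix_cst.
have fa0 : f a0 != 0.
  by rewrite /f big1 ?oner_eq0// => k _; rewrite LU det1.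
exists [set a | f a = 0]; split.
- have -> : [set a | f a = 0] = f @^-1` [set 0] by [].
  by rewrite -[X in measurable X]setTI; apply: measurable_polynomial_function.
- exact: (polynomial_function_null_zeros pf fa0).
- move=> a /= ranksN; apply: contrapT => /eqP fa; apply: ranksN => k.
  have rank_ge j : (\rank (G j a0) <= \rank (G j a))%N.
    apply: (@mulmx_unit_rank_leq _ _ _ _ _ (L j) (U j)).
    by move: fa; rewrite prodf_seq_neq0 => /allP; apply; rewrite mem_index_enum.
  apply/eqP; rewrite eqn_leq rank_ge andbT.
  have := a0_max a; rewrite /total (bigD1 k)//= [leqRHS](bigD1 k)//=.
  move=> sum_le; rewrite leqNgt; apply/negP => lt_k.
  by move: sum_le; rewrite leqNgt -addSn leq_add// leq_sum.
Qed.

(** * Trajectories with zero output *)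

Lemma is_derive_mxP (R : realType) (N : nat) (x : R -> 'cV[R]_N) (t : R)
    (dx : 'cV[R]_N) :
  is_derive t 1 x dx <-> forall i, is_derive t 1 (fun s => x s i 0) (dx i 0).
Proof.
split=> [[xd xD] i|xid].
  have /derivable_mxP xid := xd; split; first exact: xid.
  by rewrite -xD derive_mx// mxE.
have xd : derivable x t 1.
  by apply/derivable_mxP => i j; rewrite ord1; case: (xid i).
split=> //; rewrite derive_mx//; apply/colP => i; rewrite mxE.
by case: (xid i).
Qed.

Lemma is_derive_row_mul (R : realType) (N : nat) (w : 'rV[R]_N)
    (x : R -> 'cV[R]_N) (t : R) (dx : 'cV[R]_N) :
  is_derive t 1 x dx ->
  is_derive t 1 (fun s => (w *m x s) 0 0) ((w *m dx) 0 0).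
Proof.
move=> /is_derive_mxP xd.
have -> : (fun s => (w *m x s) 0 0) =
    \sum_(i < N) (w 0 i \*: (fun s => x s i 0)).
  by apply/funext => s; rewrite mxE fct_sumE.
by rewrite mxE; apply: is_derive_sum => i; apply: is_deriveZ.
Qed.

Lemma continuous_row_mul (R : realType) (N : nat) (w : 'rV[R]_N) :
  continuous (fun v : 'cV[R]_N => (w *m v) 0 0).
Proof.
have -> : (fun v : 'cV[R]_N => (w *m v) 0 0) =
    (fun v => \sum_(i < N) w 0 i * v i 0).
  by apply/funext => v; rewrite mxE.
refine (@continuous_big R 'I_N +%R 0 xpredT (@add_continuous R) _ (index_enum 'I_N) _ _).
move=> i _ v.
exact: (cvgMl_tmp (F := nbhs v) (@coord_continuous R N 1 i 0 v)).
Qed.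

(** Each point of [s] is avoided by keeping the half of the interval that does
    not contain it. *)
Lemma interval_avoids_seq (R : realType) (s : seq R) (a b : R) :
  a < b -> exists2 t, t \in `]a, b[ & t \notin s.
Proof.
elim: s a b => [|x s IHs] a b ab.
  by exists ((a + b) / 2) => //; rewrite in_itv/= !midf_lt.
have [am mb] : a < (a + b) / 2 /\ (a + b) / 2 < b by rewrite !midf_lt.
have [xm|mx] := leP x ((a + b) / 2).
  have [t] := IHs _ _ mb; rewrite in_itv/= => /andP[mt tb] ts.
  exists t; first by rewrite in_itv/= tb (lt_trans am).
  by rewrite inE negb_or ts andbT gt_eqF// (le_lt_trans xm).
have [t] := IHs _ _ am; rewrite in_itv/= => /andP[at_ tm] ts.
exists t; first by rewrite in_itv/= at_ (lt_trans tm).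
by rewrite inE negb_or ts andbT lt_eqF// (lt_trans tm).
Qed.

Lemma within_continuous_eq0 (R : realType) (T : R) (g : R -> R) (s : seq R) :
  0 < T -> {within `[0, T], continuous g} ->
  (forall t, t \in `]0, T[ -> t \notin s -> g t = 0) ->
  forall t, t \in `[0, T] -> g t = 0.
Proof.
move=> T0 cg g0 t tT; apply/eqP; apply/negPn/negP => gt0.
have : \forall u \near within `[0, T]%classic (nbhs t), g u != 0.
  rewrite nbhs_subspace_in//; apply: cvgr_neq0 gt0; exact: cg.
rewrite near_withinE => -[e /= e0 eg].
move: (tT); rewrite in_itv/= => /andP[t0 tT'].
have [u] : exists2 u, u \in `]Num.max 0 (t - e), Num.min T (t + e)[ & u \notin s.
  apply: interval_avoids_seq.
  have te : t - e < t by rewrite ltrBlDr ltrDl.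
  have et : t < t + e by rewrite ltrDl.
  by rewrite gt_max !lt_min T0 (le_lt_trans t0 et) (lt_le_trans te) ?(lt_trans te).
rewrite in_itv/= gt_max lt_min => /andP[/andP[u0 teu] /andP[uT ute]] us.
have uT' : u \in `]0, T[ by rewrite in_itv/= u0.
move: (eg u); rewrite (g0 u)// eqxx => H.
suff : false by [].
apply: H; last by rewrite /= in_itv/= !ltW.
have tu : `|t - u| < e by rewrite distrC ltr_distl teu.
exact: tu.
Qed.

(** Off [s], [w *m z] has derivative [w *m A *m z] and vanishes on a
    neighbourhood, so the derivative is 0; continuity covers the instants of [s]
    and the endpoints. *)
Lemma homogeneous_solution_derivative (R : realType) (N : nat) (A : 'M[R]_N)
    (T : R) (z : R -> 'cV[R]_N) (s : seq R) (w : 'rV[R]_N) :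
  0 < T -> {within `[0, T], continuous z} ->
  (forall t, t \in `]0, T[ -> t \notin s -> is_derive t 1 z (A *m z t)) ->
  (forall t, t \in `[0, T] -> w *m z t = 0) ->
  forall t, t \in `[0, T] -> (w *m A) *m z t = 0.
Proof.
move=> T0 cz dz wz0.
suff wAz0 t : t \in `[0, T] -> ((w *m A) *m z t) 0 0 = 0.
  by move=> t /wAz0 wAzt; apply/rowP => i; rewrite ord1 wAzt mxE.
move: t; apply: (within_continuous_eq0 (s := s)) => //.
  apply: (@within_continuous_comp _ _ _ _ z (fun v => (w *m A *m v) 0 0)) => //.
  by move=> v _; exact: continuous_row_mul.
move=> t tT ts; have := is_derive_row_mul w (dz t tT ts).
rewrite mulmxA => dwz.
have near0 : \near t, (w *m z t) 0 0 = (cst 0 : R -> R) t.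
  near=> u; rewrite wz0 ?mxE//; apply: subset_itv_oo_cc.
  by near: u; exact: near_in_itvoo.
have /(near_eq_is_derive near0) [_ <-] := dwz.
by rewrite derive_cst.
Unshelve. all: by end_near. Qed.

Lemma homogeneous_solution_unobserved (R : realType) (N P : nat) (A : 'M[R]_N)
    (C : 'M[R]_(P, N)) (T : R) (z : R -> 'cV[R]_N) (s : seq R) :
  0 < T -> {within `[0, T], continuous z} ->
  (forall t, t \in `]0, T[ -> t \notin s -> is_derive t 1 z (A *m z t)) ->
  (forall t, t \in `[0, T] -> C *m z t = 0) ->
  forall t, t \in `[0, T] -> nonobservable_subspace A C (z t).
Proof.
move=> T0 cz dz Cz0 t tT.
have CAz k i : forall t, t \in `[0, T] -> row i (C *m A ^+ k) *m z t = 0.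
  elim: k => [|k IHk].
    by move=> u uT; rewrite expr0 mulmx1 -row_mul Cz0// row0.
  rewrite exprSr -mulmxE mulmxA row_mul.
  exact: homogeneous_solution_derivative dz IHk.
rewrite /nonobservable_subspace /observability_matrix/=.
apply/mxcolP => k; rewrite submxcol0 -submxcol_mul mxcolK.
by apply/row_matrixP => i; rewrite row0 row_mul CAz.
Qed.

(** Cayley-Hamilton: [A ^+ k] is a combination of the powers of exponent less
    than [N]. *)
Lemma nonobservable_subspace_powers (R : realType) (N P : nat) (A : 'M[R]_N)
    (C : 'M[R]_(P, N)) (v : 'cV[R]_N) :
  nonobservable_subspace A C v -> forall k, C *m A ^+ k *m v = 0.
Proof.
move=> Ov.
have CAv (k : nat) : (k < N)%N -> C *m A ^+ k *m v = 0.
  move=> kN; have := congr1 (fun D => submxcol D (Ordinal kN)) Ov.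
  by rewrite submxcol0 -submxcol_mul mxcolK.
case: N A C v Ov CAv => [|N] A C v _ CAv k.
  (* Cayley-Hamilton requires a matrix of positive size *)
  by rewrite [v]flatmx0 mulmx0.
have chiA0 := Cayley_Hamilton A.
pose r := modp ('X^k : {poly R}) (char_poly A).
have size_r : (size r <= N.+1)%N.
  by rewrite -ltnS -(size_char_poly A) ltn_modp -size_poly_eq0 size_char_poly.
have -> : A ^+ k = horner_mx A r.
  rewrite -{1}(horner_mx_X A) -rmorphXn/= {1}(divp_eq 'X^k (char_poly A)).
  by rewrite rmorphD rmorphM/= chiA0 mulr0 add0r.
rewrite -[r]coefK poly_def linear_sum/= mulmx_sumr mulmx_suml.
apply: big1 => i _; rewrite linearZ/= rmorphXn/= horner_mx_X.
by rewrite -scalemxAr -scalemxAl CAv ?scaler0// (leq_trans (ltn_ord i)).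
Qed.

(** * The flow of a vector that produces no output *)

Definition flow_coefficient (R : realType) (N : nat) (w : 'rV[R]_N)
    (A : 'M[R]_N) (v : 'cV[R]_N) : R^nat :=
  fun k => (w *m A ^+ k *m v) 0 0 / k`!%:R.

(** This is w e^(tA) v, as a power series in t. *)
Definition flow_functional (R : realType) (N : nat) (w : 'rV[R]_N)
    (A : 'M[R]_N) (v : 'cV[R]_N) (t : R) : R :=
  limn (pseries (flow_coefficient w A v) t).

(** Differentiation of the series replaces [w] by [w *m A], because
    d/dt (w e^(tA) v) = w A e^(tA) v. *)
Lemma pseries_diffs_flow_coefficient (R : realType) (N : nat) (w : 'rV[R]_N)
    (A : 'M[R]_N) (v : 'cV[R]_N) :
  pseries_diffs (flow_coefficient w A v) = flow_coefficient (w *m A) A v.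
Proof.
apply/funext => k; rewrite /pseries_diffs /flow_coefficient.
rewrite exprS -mulmxE mulmxA factS natrM invfM mulrCA mulVKf//.
Qed.

Lemma normr_row_mul_leq (R : realType) (N : nat) (w : 'rV[R]_N)
    (v : 'cV[R]_N) (c : R) :
  (forall i, `|v i 0| <= c) -> `|(w *m v) 0 0| <= (\sum_i `|w 0 i|) * c.
Proof.
move=> vc; rewrite mxE (le_trans (ler_norm_sum _ _ _))// mulr_suml.
by apply: ler_sum => i _; rewrite normrM ler_wpM2l.
Qed.

Lemma flow_coefficient_bound (R : realType) (N : nat) (w : 'rV[R]_N)
    (A : 'M[R]_N) (v : 'cV[R]_N) :
  exists c K : R, [/\ 0 <= c, 0 <= K &
    forall k, `|flow_coefficient w A v k| <= c * (K ^+ k / k`!%:R)].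
Proof.
(* the 1-norm of v, and the sum of the moduli of the entries of A, which bounds
   the growth of each entry of A ^+ k *m v *)
pose V := \sum_i `|v i 0|; pose K := \sum_i \sum_j `|A i j|.
have V0 : 0 <= V by exact: sumr_ge0.
have K0 : 0 <= K by apply: sumr_ge0 => i _; exact: sumr_ge0.
have AkvV k i : `|(A ^+ k *m v) i 0| <= K ^+ k * V.
  elim: k i => [|k IHk] i.
    by rewrite expr0 mul1mx mul1r /V (bigD1 i)//= lerDl sumr_ge0.
  rewrite exprS -mulmxE -mulmxA.
  have -> : (A *m (A ^+ k *m v)) i 0 = (row i A *m (A ^+ k *m v)) 0 0.
    by rewrite -row_mul [RHS]mxE.
  rewrite (le_trans (normr_row_mul_leq _ IHk))// exprS -mulrA.
  rewrite ler_wpM2r ?mulr_ge0 ?exprn_ge0// /K [leRHS](bigD1 i)//=.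
  under eq_bigr do rewrite mxE.
  by rewrite lerDl; apply: sumr_ge0 => j _; exact: sumr_ge0.
exists ((\sum_i `|w 0 i|) * V), K; split => //.
  by rewrite mulr_ge0// sumr_ge0.
move=> k; rewrite /flow_coefficient -mulmxA normrM normfV normr_nat mulrA.
rewrite ler_wpM2r ?invr_ge0//.
by rewrite (le_trans (normr_row_mul_leq _ (AkvV k)))// -mulrA [V * _]mulrC.
Qed.

Lemma is_cvg_flow_functional (R : realType) (N : nat) (w : 'rV[R]_N)
    (A : 'M[R]_N) (v : 'cV[R]_N) (t : R) :
  cvgn (pseries (flow_coefficient w A v) t).
Proof.
have [c [K [c0 K0 coefK]]] := flow_coefficient_bound w A v.
apply: normed_cvg.
apply: (@series_le_cvg _ _ (c *: exp_coeff (K * `|t|))).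
- by move=> k; exact: normr_ge0.
- by move=> k; rewrite mulr_ge0// exp_coeff_ge0// mulr_ge0.
- move=> k; rewrite /= normrM normrX.
  rewrite (le_trans (ler_wpM2r _ (coefK k))) ?exprn_ge0//.
  by rewrite -mulrA ler_wpM2l// /exp_coeff/= exprMn mulrAC.
- exact/is_cvg_seriesZ/is_cvg_series_exp_coeff.
Qed.

Lemma is_derive_flow_functional (R : realType) (N : nat) (w : 'rV[R]_N)
    (A : 'M[R]_N) (v : 'cV[R]_N) (t : R) :
  is_derive t 1 (flow_functional w A v) (flow_functional (w *m A) A v t).
Proof.
rewrite /flow_functional -pseries_diffs_flow_coefficient.
apply: (@pseries_snd_diffs _ _ (`|t| + 1));
  rewrite ?pseries_diffs_flow_coefficient; try exact: is_cvg_flow_functional.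
by rewrite [ltRHS]ger0_norm ?addr_ge0// ltrDl.
Qed.

(** Every row is recovered from the canonical ones.  Applied to the rows of [A],
    this turns the derivatives of the coordinates of e^(tA) v into the equation
    x' = A x; applied to the rows of [C], it computes the output. *)
Lemma flow_functional_linear (R : realType) (N : nat) (w : 'rV[R]_N)
    (A : 'M[R]_N) (v : 'cV[R]_N) (t : R) :
  flow_functional w A v t =
  (w *m \col_i flow_functional (delta_mx 0 i) A v t) 0 0.
Proof.
rewrite mxE; under eq_bigr do rewrite mxE.
apply: cvg_lim => //.
have -> : pseries (flow_coefficient w A v) t =
    (fun n => \sum_i w 0 i * pseries (flow_coefficient (delta_mx 0 i) A v) t n).
  apply/funext => n; rewrite /pseries /series/=.
  under [RHS]eq_bigr do rewrite mulr_sumr.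
  rewrite exchange_big/=; apply: eq_bigr => k _.
  under eq_bigr do rewrite mulrA.
  rewrite -mulr_suml; congr (_ * _); rewrite /flow_coefficient.
  under eq_bigr do rewrite mulrA.
  rewrite -mulr_suml; congr (_ / _).
  rewrite -mulmxA mxE; apply: eq_bigr => i _.
  by congr (_ * _); rewrite -mulmxA -rowE [RHS]mxE.
apply: (@cvg_big R 'I_N +%R 0 xpredT (@add_continuous R)) => i _.
have := @is_cvg_flow_functional _ _ (delta_mx 0 i) A v t.
exact: cvgMl_tmp.
Qed.

Lemma flow_functional0 (R : realType) (N : nat) (w : 'rV[R]_N)
    (A : 'M[R]_N) (v : 'cV[R]_N) :
  flow_functional w A v 0 = (w *m v) 0 0.
Proof.
apply: cvg_lim => //; rewrite -(cvg_shiftn 1).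
apply: cvg_near_cst; near=> n.
rewrite /pseries /series/= addn1 big_nat_recl// big1 ?addr0.
  by rewrite /flow_coefficient !expr0 mulmx1 fact0 divr1 mulr1.
by move=> k _; rewrite expr0n mulr0.
Unshelve. all: by end_near. Qed.

(** The output of e^(tA) v is a power series whose coefficients C A^k v / k! are
    all zero. *)
Lemma nonobservable_flow (R : realType) (N P : nat) (A : 'M[R]_N)
    (C : 'M[R]_(P, N)) (v : 'cV[R]_N) :
  nonobservable_subspace A C v ->
  exists x : R -> 'cV[R]_N,
    [/\ x 0 = v, forall t : R, is_derive t 1 x (A *m x t) &
        forall t, C *m x t = 0].
Proof.
move=> Ov; exists (fun t => \col_i flow_functional (delta_mx 0 i) A v t); split.
- by apply/colP => i; rewrite mxE flow_functional0 -rowE mxE.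
- move=> t; apply/is_derive_mxP => i.
  have -> : (A *m \col_i flow_functional (delta_mx 0 i) A v t) i 0 =
      flow_functional (delta_mx 0 i *m A) A v t.
    by rewrite flow_functional_linear -mulmxA -rowE [RHS]mxE.
  under eq_fun do rewrite mxE.
  exact: is_derive_flow_functional.
- move=> t; apply/matrixP => p j; rewrite ord1.
  transitivity (flow_functional (row p C) A v t).
    by rewrite flow_functional_linear -row_mul [RHS]mxE.
  rewrite [RHS]mxE; apply: lim_near_cst => //; near=> n.
  rewrite /pseries /series/= big1// => k _.
  rewrite /flow_coefficient -!row_mul (nonobservable_subspace_powers Ov).
  by rewrite row0 mxE !mul0r.
Unshelve. all: by end_near. Qed.

(** * The set of observable nodes *)

Definition reconstructible_nodes (R : realType) (N P : nat) (A : 'M[R]_N)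
    (C : 'M[R]_(P, N)) : {set 'I_N} :=
  [set j | ((delta_mx 0 j : 'rV[R]_N) <= observability_matrix A C)%MS].

Lemma basis_vector_orthogonalE (R : realType) (N : nat) (j : 'I_N)
    (V : set 'cV[R]_N) :
  orthogonal_to (basis_vector R j) V <-> forall v, V v -> v j 0 = 0.
Proof.
have coordE v : (basis_vector R j)^T *m v = (v j 0)%:M.
  rewrite trmx_delta -rowE; apply/matrixP => i k.
  by rewrite !ord1 !mxE eqxx mulr1n.
split=> ort v Vv; last by rewrite coordE ort// raddf0.
have := ort v Vv; rewrite coordE.
by move=> /matrixP/(_ 0 0); rewrite !mxE eqxx mulr1n.
Qed.

(** The columns of the cokernel of a matrix span the vectors that it
    annihilates, and a row lies in the row space exactly when it annihilates
    the cokernel. *)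
Lemma reconstructible_nodesP (R : realType) (N P : nat) (A : 'M[R]_N)
    (C : 'M[R]_(P, N)) (j : 'I_N) :
  reflect (orthogonal_to (basis_vector R j) (nonobservable_subspace A C))
    (j \in reconstructible_nodes A C).
Proof.
rewrite inE; apply: (iffP idP) => [/submxP[D jD] v Ov|ort].
  by rewrite trmx_delta jD -mulmxA Ov mulmx0.
rewrite submxE; apply/eqP/matrixP => i k; rewrite [RHS]mxE.
set K := cokermx _.
have OK : nonobservable_subspace A C (col k K).
  by rewrite /nonobservable_subspace/= colE mulmxA mulmx_coker mul0mx.
have /matrixP/(_ i 0) := ort _ OK.
by rewrite trmx_delta colE mulmxA -colE [LHS]mxE => ->; rewrite mxE.
Qed.

(** If e_j is not orthogonal to the non observable subspace, some v in it has a
    nonzero j-th coordinate, and e^(tA) v is distinguished from the zero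
    trajectory at time 0 by node j but never by the output. *)
Lemma simultaneously_observableE (R : realType) (N M P : nat) (A : 'M[R]_N)
    (B : 'M[R]_(N, M)) (C : 'M[R]_(P, N)) (T : R) (S : {set 'I_N}) :
  0 < T ->
  simultaneously_observable A B C T S <-> S \subset reconstructible_nodes A C.
Proof.
move=> T0; split=> [obsS|/fintype.subsetP SO u x x'
  [cx [s dx]] [cx' [s' dx']] Cxx' t tT].
  apply/fintype.subsetP => j jS; apply/reconstructible_nodesP.
  apply/basis_vector_orthogonalE => v /nonobservable_flow[x [<- dx Cx0]].
  have x_traj : trajectory A B T (cst 0) x.
    split; last by exists [::] => t _ _; rewrite /= mulmx0 addr0; exact: dx.
    by apply: derivable_within_continuous => t _; case: (dx t).
  have rest_traj : trajectory A B T (cst 0) (cst 0).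
    split; first by move=> t; exact: cvg_cst.
    by exists [::] => t _ _; rewrite /= !mulmx0 addr0; exact: is_derive_cst.
  rewrite (obsS _ _ _ x_traj rest_traj _ 0 _ _ jS) ?mxE//.
    by move=> t _; rewrite Cx0 mulmx0.
  by rewrite in_itv/= lexx ltW.
move=> j /SO/reconstructible_nodesP/basis_vector_orthogonalE ort_j.
apply/eqP; rewrite -subr_eq0; apply/eqP.
have -> : x t j 0 - x' t j 0 = ((x - x') t) j 0 by rewrite !mxE.
apply: ort_j; apply: (homogeneous_solution_unobserved T0 _ _ _ tT (s := s ++ s')).
- exact: within_continuousB.
- move=> r rT; rewrite mem_cat negb_or => /andP[rs rs'].
  have -> : A *m (x - x') r =
      (A *m x r + B *m u r) - (A *m x' r + B *m u r).
    by rewrite opprD addrACA subrr addr0 -mulmxBr.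
  by apply: is_deriveB; [exact: dx | exact: dx'].
- by move=> r rT; rewrite mulmxBr Cxx'// subrr.
Qed.

Lemma observable_nodesE (R : realType) (N M P : nat) (A : 'M[R]_N)
    (B : 'M[R]_(N, M)) (C : 'M[R]_(P, N)) (T : R) (O : {set 'I_N}) :
  0 < T -> observable_nodes A B C T O <-> O = reconstructible_nodes A C.
Proof.
have simE S := simultaneously_observableE A B C S.
move=> T0; split=> [/maxsetP[/asboolP/simE-/(_ T0) sub max]|->].
  apply/esym/max => //; apply/asboolP/simultaneously_observableE => //.
apply/maxsetP; split=> [|S /asboolP/simultaneously_observableE-/(_ T0) sub sup].
  exact/asboolP/simultaneously_observableE.
by apply/eqP; rewrite finset.eqEsubset sub sup.
Qed.

Lemma max_orthogonal_basis_vectorsE (R : realType) (N P : nat) (A : 'M[R]_N)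
    (C : 'M[R]_(P, N)) :
  max_orthogonal_basis_vectors (nonobservable_subspace A C) =
  #|reconstructible_nodes A C|.
Proof.
apply/eqP; rewrite eqn_leq; apply/andP; split.
  apply/bigmax_leqP => S /forall_inP ortS; apply: subset_leq_card.
  apply/fintype.subsetP => j jS.
  exact/reconstructible_nodesP/asboolP/ortS.
apply: (bigop.bigmax_sup (reconstructible_nodes A C)) => //.
by apply/forall_inP => j /reconstructible_nodesP ?; exact/asboolP.
Qed.

Lemma polynomial_observability_matrix (R : realType) (N P : nat)
    (C : 'M[R]_(P, N)) (F : {set 'I_N * 'I_N}) :
  polynomial_matrix (fun a : #|F|.-tuple R =>
    observability_matrix (matrix_of_free_entries a) C).
Proof.
have pA : polynomial_matrix (fun a : #|F|.-tuple R => matrix_of_free_entries a).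
  move=> i j; rewrite /matrix_of_free_entries; under eq_fun do rewrite mxE.
  case: (boolP ((i, j) \in F)) => ijF; last exact: polynomial_function_cst.
  have kF : (index (i, j) (enum F) < #|F|)%N.
    by rewrite cardE index_mem mem_enum.
  under eq_fun do rewrite -[index _ _]/(nat_of_ord (Ordinal kF)) -tnth_nth.
  exact: polynomial_function_tnth.
move=> i j; under eq_fun do rewrite mxE.
apply: polynomial_matrixM; first exact: polynomial_matrix_cst.
exact: polynomial_matrixX.
Qed.

(** The zero row puts both ranks in the form of one family of matrices of a
    common size, to which [generic_rank] applies. *)
Lemma mem_reconstructible_rank (R : realType) (N P : nat) (A : 'M[R]_N)
    (C : 'M[R]_(P, N)) (j : 'I_N) :
  (j \in reconstructible_nodes A C) =
  (\rank (col_mx (observability_matrix A C) (delta_mx 0 j : 'rV_N)) ==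
   \rank (col_mx (observability_matrix A C) (0 : 'rV_N))).
Proof.
set D := observability_matrix A C; set w : 'rV_N := delta_mx 0 j.
have /mxrank_leqif_sup/= [_] : (D <= D + w)%MS by exact: addsmxSl.
by rewrite inE addsmx_sub submx_refl/= -!addsmxE addsmx0 eq_sym => <-.
Qed.

Lemma generic_reconstructible_nodes (R : realType) (N P : nat)
    (C : 'M[R]_(P, N)) (F : {set 'I_N * 'I_N}) :
  exists O : {set 'I_N}, (@tuple_lebesgue R #|F|).-negligible
    [set a | reconstructible_nodes (matrix_of_free_entries a) C <> O].
Proof.
pose added (k : option 'I_N) : 'rV[R]_N := oapp (delta_mx 0) 0 k.
pose G k (a : #|F|.-tuple R) :=
  col_mx (observability_matrix (matrix_of_free_entries a) C) (added k).
have pG k : polynomial_matrix (G k).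
  move=> i j; rewrite /G -(splitK i); case: (fintype.split i) => l /=.
    under eq_fun do rewrite col_mxEu.
    exact: polynomial_observability_matrix.
  under eq_fun do rewrite col_mxEd.
  exact: polynomial_function_cst.
have [a0 [X [mX X0 subX]]] := generic_rank pG.
exists (reconstructible_nodes (matrix_of_free_entries a0) C).
exists X; split => // a /= neq; apply: subX => /= rankG; apply: neq.
apply/setP => j; rewrite !mem_reconstructible_rank.
by rewrite (rankG (Some j)) (rankG None).
Qed.

Theorem theorem1 (R : realType) (N M P : nat)
    (B : 'M[R]_(N, M)) (C : 'M[R]_(P, N)) (hC : rows_are_unit C)
    (T : R) (hT : 0 < T) :
  (forall A : 'M[R]_N,
     (forall O : {set 'I_N}, observable_nodes A B C T O ->
        #|O| = max_orthogonal_basis_vectors (nonobservable_subspace A C))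
     /\ (exists! O : {set 'I_N}, observable_nodes A B C T O))
  /\ (forall F : {set 'I_N * 'I_N},
        exists O : {set 'I_N},
          (@tuple_lebesgue R #|F|).-negligible
            [set a : #|F|.-tuple R |
               ~ observable_nodes (matrix_of_free_entries a) B C T O]).
Proof.
split=> [A|F].
  have obsE O := observable_nodesE A B C O hT.
  split=> [S /obsE -> |]; first by rewrite max_orthogonal_basis_vectorsE.
  exists (reconstructible_nodes A C); split; first exact/obsE.
  by move=> S /obsE.
have [S [X [mX X0 subX]]] := generic_reconstructible_nodes C F.
exists S; exists X; split=> // a /= unobs; apply: subX => /= aO.
by apply: unobs; apply/observable_nodesE.
Qed.
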